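(* Let $k\ge 1$. The map $$I\mapsto f(I)=f_L(I\cap L)\ \cup\ \bigl(Q^-\setminus f_R(I\cap R)\bigr)$$ is a bijection between the set of order ideals $I$ of $P'$ such that there is no $1\le x_0\le k$ with $l_{x_0},r_{x_0}\in I$ and no $1\le x_1<k$ with $r_{x_1},l_{x_1+1}\in I$, and the set of balanced order ideals of $Q$.
   Context: $\mathbb{N}$ denotes the non-negative integers. Let $F=(2k+1)(2k+3)-(2k+1)-(2k+3)$ and $P'=\{(a,b)\in\mathbb{N}^2\mid (2k+1)a+(2k+3)b\le F\}$, with partial order $(a_1,b_1)\le(a_0,b_0)$ iff $a_0\le a_1$ and $b_0\le b_1$. Let $L=\{(a,b)\in P'\mid a>b,\ a+b\le 2k\}$, $R=\{(a,b)\in P'\mid a\le b,\ a+b\le 2k-1\}$. For $1\le i\le k$, $l_i=(k+i,k-i)$ and $r_i=(i-1,2k-i)$. Let $Q=\{(a,b)\in\mathbb{Z}^2\mid 1\le a-b\le 2k+2\}$, partially ordered as the reflexive-transitive closure of $(a,b)\ge(a+1,b)$ and $(a,b)\ge(a,b+1)$; let $Q^+=\{(a,b)\in Q\mid a+b\le 2k\}$ and $Q^-=\{(a,b)\in Q\mid a+b\ge 2k+1\}$. Define $f_L:L\to Q^+$ by $f_L(a,b)=(a,b)$ and $f_R:R\to Q^-$ by $f_R(a,b)=(3k+1-b,\,k-1-a)$. An order ideal of a poset is a subset $J$ with $y\in J$, $x\le y\Rightarrow x\in J$. For a proper ($J\ne Q$), non-empty order ideal $J$ of $Q$ and $0\le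 p\le 2k+1$, the height $h_J(p)$ is the maximum of $2k+1-a-b$ over $(a,b)\in J$ with $a-b=2k+2-p$. Such $J$ is balanced if $h_J(0)<0$, $h_J(2k+1)\ge 0$, and $|h_J(0)+h_J(2k+1)|=1$. *)

(* Defs.v *)
From Stdlib Require Import Relation_Operators.
From mathcomp Require Import all_boot all_order all_algebra.
From mathcomp Require Import boolp classical_sets functions.

Set Implicit Arguments.
Unset Strict Implicit.
Unset Printing Implicit Defensive.

Import Order.TTheory GRing.Theory Num.Theory.
Local Open Scope classical_set_scope.
Local Open Scope ring_scope.

(* Posets are encoded as a carrier [P : set T] together with a relation [le] on
   the ambient type; only its values on [P] matter. *)
Definition order_ideal (T : Type) (P : set T) (le : T -> T -> Prop)
    (J : set T) : Prop :=
  J `<=` P /\ forall x y, P x -> J y -> le x y -> J x.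

(* F is an integer, so that its subtractions are not truncated. *)
Definition Fnum (k : nat) : int :=
  (2 * k%:Z + 1) * (2 * k%:Z + 3) - (2 * k%:Z + 1) - (2 * k%:Z + 3).

Definition Pprime (k : nat) : set (nat * nat) :=
  [set x | (2 * k%:Z + 1) * x.1%:Z + (2 * k%:Z + 3) * x.2%:Z <= Fnum k].

(* Larger coordinates are lower in the order. *)
Definition leP' (x y : nat * nat) : Prop := ((y.1 <= x.1) && (y.2 <= x.2))%N.

Definition Lset (k : nat) : set (nat * nat) :=
  [set x | Pprime k x /\ (x.2 < x.1)%N /\ (x.1 + x.2 <= 2 * k)%N].

Definition Rset (k : nat) : set (nat * nat) :=
  [set x | Pprime k x /\ (x.1 <= x.2)%N /\ (x.1 + x.2 <= 2 * k - 1)%N].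

(* Used for 1 <= i <= k only, where no subtraction is truncated. *)
Definition lpt (k i : nat) : nat * nat := (k + i, k - i)%N.
Definition rpt (k i : nat) : nat * nat := (i - 1, 2 * k - i)%N.

Definition Qset (k : nat) : set (int * int) :=
  [set x | 1 <= x.1 - x.2 <= 2 * k%:Z + 2].

(* The generating relations of the order on Q relate points of Q only. *)
Definition Qstep (k : nat) (x y : int * int) : Prop :=
  [/\ Qset k x, Qset k y & x = (y.1 + 1, y.2) \/ x = (y.1, y.2 + 1)].

Definition leQ (k : nat) : int * int -> int * int -> Prop :=
  clos_refl_trans (int * int) (Qstep k).

Definition Qplus (k : nat) : set (int * int) :=
  [set x | Qset k x /\ x.1 + x.2 <= 2 * k%:Z].

Definition Qminus (k : nat) : set (int * int) :=
  [set x | Qset k x /\ 2 * k%:Z + 1 <= x.1 + x.2].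

(* f_L and f_R are given on all of N^2, but are only applied to subsets of L
   and R, which they map to Q^+ and Q^- respectively. *)
Definition fL (x : nat * nat) : int * int := (x.1%:Z, x.2%:Z).

Definition fR (k : nat) (x : nat * nat) : int * int :=
  (3 * k%:Z + 1 - x.2%:Z, k%:Z - 1 - x.1%:Z).

Definition fmap (k : nat) (I : set (nat * nat)) : set (int * int) :=
  (fL @` (I `&` Lset k)) `|` (Qminus k `\` (fR k @` (I `&` Rset k))).

Definition height_values (k : nat) (J : set (int * int)) (p : nat) : set int :=
  [set 2 * k%:Z + 1 - x.1 - x.2
    | x in [set x | J x /\ x.1 - x.2 = 2 * k%:Z + 2 - p%:Z]].

(* The maximum exists when J is a proper non-empty order ideal of Q and
   p <= 2k+1; the default value 0 is irrelevant then. *)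
Definition height (k : nat) (J : set (int * int)) (p : nat) : int :=
  xget 0 [set h | height_values k J p h /\ ubound (height_values k J p) h].

Definition balanced (k : nat) (J : set (int * int)) : Prop :=
  [/\ order_ideal (Qset k) (leQ k) J, J <> Qset k, J <> set0 &
    [/\ height k J 0 < 0, 0 <= height k J (2 * k + 1) &
        `|height k J 0 + height k J (2 * k + 1)| = 1]].

Definition admissible (k : nat) (I : set (nat * nat)) : Prop :=
  [/\ order_ideal (Pprime k) leP' I,
    ~ (exists x0 : nat, [/\ (1 <= x0 <= k)%N, I (lpt k x0) & I (rpt k x0)]) &
    ~ (exists x1 : nat,
        [/\ (1 <= x1 < k)%N, I (rpt k x1) & I (lpt k x1.+1)])].

(* Main.v *)
(** Splitting P' by the sign of a - b gives L and R exactly: f_L identifies L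
with the part b >= 0 of Q^+, and f_R reverses the order and identifies R with
the part b < k of Q^-. The forbidden pairs (l_x, r_x) and (r_x, l_(x+1)) are the
pairs whose images are a covering pair across the line between Q^+ and Q^-, so
excluding them makes f(I) an order ideal.

An ideal J of Q meets the extreme diagonals a - b = 2k + 2 and a - b = 1 in rays
b >= r and b >= l, and balancedness says r >= 0, l <= k and r + l = k or k - 1.
The first two conditions say that J avoids b < 0 and contains b >= k, so that J
is determined by its traces on the images of L and R. The last one compensates
for the cut along a = b: the order relations of P' between L and R all pass
through this diagonal and its neighbour a = b + 1. *)

Require Import Defs.
From Stdlib Require Import Relation_Operators.
From mathcomp Require Import all_boot all_order all_algebra.
From mathcomp Require Import boolp classical_sets functions.
From mathcomp Require Import zify.

Set Implicit Arguments.
Unset Strict Implicit.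
Unset Printing Implicit Defensive.

Import Order.TTheory GRing.Theory Num.Theory.
Local Open Scope classical_set_scope.

(** * Linear descriptions of P', L and R *)

(** With s = a + b and d = a - b the defining inequality reads (2k+2)(s - 2k) <= d - 1, and |d| <= s
    settles it unless s = 2k. *)
Lemma PprimeE (k a b : nat) :
  Pprime k (a, b) <-> ((a + b < 2 * k) || (a + b == 2 * k) && (b < a))%N.
Proof.
rewrite /Pprime /Fnum /=; split => H; last by nia.
have: (a + b <= 2 * k)%N.
  by rewrite leqNgt; apply/negP => ?; nia.
case: ltngtP => //= e _; nia.
Qed.

Lemma LsetE (k a b : nat) : Lset k (a, b) <-> (b < a)%N /\ (a + b <= 2 * k)%N.
Proof.
by rewrite /Lset /= PprimeE; split=> [[_ //]|[? ?]]; split=> //; lia.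
Qed.

Lemma RsetE (k a b : nat) : Rset k (a, b) <-> (a <= b)%N /\ (a + b < 2 * k)%N.
Proof. by rewrite /Rset /= PprimeE; split=> [[? [? ?]]|[? ?]]; lia. Qed.

Lemma Pprime_LR (k : nat) (x : nat * nat) : Pprime k x -> Lset k x \/ Rset k x.
Proof.
case: x => a b; rewrite PprimeE LsetE RsetE => ?.
by case: (ltnP b a) => ?; [left|right]; lia.
Qed.

Local Open Scope ring_scope.

(** * The order on Q is the componentwise one *)

Lemma QsetE (k : nat) (a b : int) :
  Qset k (a, b) <-> 1 <= a - b /\ a - b <= 2 * k%:Z + 2.
Proof. by rewrite /Qset /=; split=> [/andP|?]; [|apply/andP]. Qed.

Lemma leQ_coord (k : nat) (x y : int * int) :
  leQ k x y -> y.1 <= x.1 /\ y.2 <= x.2.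
Proof.
elim=> [u v [_ _ [->|->]]|u|u v w _ ? _ ?] /=; lia.
Qed.

(* The strip Q contains a monotone lattice path between any two of its
   componentwise comparable points. *)
Lemma coord_leQ (k : nat) (x y : int * int) :
  Qset k x -> Qset k y -> y.1 <= x.1 -> y.2 <= x.2 -> leQ k x y.
Proof.
case: x => c d; have [n] := ubnP (absz (c - y.1 + (d - y.2))).
elim: n y => // n IHn [a b] /= n_gt Qx Qy ac bd.
move/QsetE: (Qx) => [? ?]; move/QsetE: (Qy) => [? ?].
have step z : Qset k z -> z = (a + 1, b) \/ z = (a, b + 1) ->
    z.1 <= c -> z.2 <= d -> leQ k (c, d) (a, b).
  move=> Qz ez zc zd; apply: (rt_trans _ _ _ z); last by apply: rt_step; split.
  by apply: IHn => //; case: ez zc zd => -> /=; lia.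
have [ac'|ca] := ltrP a c.
  have [w|w] := ltrP (a - b) (2 * k%:Z + 2).
    by apply: (step (a + 1, b)); [apply/QsetE; lia|left| |] => //=; lia.
  (* On the edge a - b = 2k + 2 the first coordinate cannot grow, but a < c and c - d <= 2k + 2
     force b < d. *)
  by apply: (step (a, b + 1)); [apply/QsetE; lia|right| |] => //=; lia.
have [bd'|db] := ltrP b d.
  by apply: (step (a, b + 1)); [apply/QsetE; lia|right| |] => //=; lia.
have -> : c = a by lia.
have -> : d = b by lia.
exact: rt_refl.
Qed.

Lemma order_ideal_QE (k : nat) (J : set (int * int)) :
  order_ideal (Qset k) (leQ k) J <->
  J `<=` Qset k /\
  forall a b c d, Qset k (c, d) -> J (a, b) -> a <= c -> b <= d -> J (c, d).
Proof.
split=> -[JQ Jup]; split=> //.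
  move=> a b c d Qx Jy ? ?; apply: (Jup _ (a, b)) => //.
  by apply: coord_leQ => //; exact: JQ.
by move=> [c d] [a b] Qx Jy /leQ_coord[? ?]; exact: (Jup a b).
Qed.

(** * Images of f_L and f_R, and membership in f(I) *)

Lemma QplusP (k : nat) (a b : int) : Qplus k (a, b) -> 0 <= b ->
  exists2 x, Lset k x & fL x = (a, b).
Proof.
rewrite /Qplus /= QsetE => ? ?; exists (`|a|%N, `|b|%N).
  by apply/LsetE; lia.
by rewrite /fL /=; congr pair; lia.
Qed.

Lemma QminusP (k : nat) (a b : int) : Qminus k (a, b) -> b < k%:Z ->
  exists2 x, Rset k x & fR k x = (a, b).
Proof.
rewrite /Qminus /= QsetE => ? ?.
exists (absz (k%:Z - 1 - b)%R, absz (3 * k%:Z + 1 - a)%R).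
  by apply/RsetE; lia.
by rewrite /fR /=; congr pair; lia.
Qed.

Lemma fL_Qplus (k : nat) (x : nat * nat) : Lset k x -> Qplus k (fL x).
Proof. by case: x => a b; rewrite LsetE /Qplus /fL /= QsetE; lia. Qed.

Lemma fR_Qminus (k : nat) (x : nat * nat) : Rset k x -> Qminus k (fR k x).
Proof. by case: x => a b; rewrite RsetE /Qminus /fR /= QsetE; lia. Qed.

Lemma Qplus_minus (k : nat) (z : int * int) : Qplus k z -> ~ Qminus k z.
Proof. by case=> _ ? [_ ?]; lia. Qed.

Lemma fmap_fL (k : nat) (I : set (nat * nat)) (x : nat * nat) :
  Lset k x -> fmap k I (fL x) <-> I x.
Proof.
move=> Lx; split=> [[[[a b] [Iy _]]|[/(Qplus_minus (fL_Qplus Lx))//]]|Ix].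
  by case: x {Lx} => c d [? ?]; have [-> ->] : c = a /\ d = b by lia.
by left; exists x.
Qed.

Lemma fmap_fR (k : nat) (I : set (nat * nat)) (x : nat * nat) :
  Rset k x -> fmap k I (fR k x) <-> ~ I x.
Proof.
move=> Rx; split=> [[[y [_ Ly] e]|[_ nI] Ix]|nIx].
- case: (@Qplus_minus k (fL y)); first exact: fL_Qplus.
  by rewrite e; exact: fR_Qminus.
- by apply: nI; exists x.
- right; split; first exact: fR_Qminus.
  case=> -[a b] [Iy _]; case: x nIx {Rx} => c d nI [? ?]; apply: nI.
  by have [-> ->] : c = a /\ d = b by lia.
Qed.

Lemma fmap_top (k : nat) (I : set (nat * nat)) (a b : int) :
  Qminus k (a, b) -> k%:Z <= b -> fmap k I (a, b).
Proof. by move=> Qz kb; right; split=> // -[[c d] _ [_ ?]]; lia. Qed.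

(** On Q^-, 2b = (a + b) - (a - b) >= -1, so b >= 0 there too. *)
Lemma fmap_ge0 (k : nat) (I : set (nat * nat)) (a b : int) :
  fmap k I (a, b) -> 0 <= b.
Proof.
case=> [[[c d] _ [_ <-]] //|[]]; rewrite /Qminus /= QsetE => ? _; lia.
Qed.

(** * Heights *)

(** Along a diagonal 2k + 1 - a - b decreases in b, so the maximum sits at the least b. *)
Lemma height_eq (k : nat) (J : set (int * int)) (p : nat) (a b : int) :
  J (a, b) -> a - b = 2 * k%:Z + 2 - p%:Z ->
  (forall c d, J (c, d) -> c - d = 2 * k%:Z + 2 - p%:Z -> b <= d) ->
  height k J p = 2 * k%:Z + 1 - a - b.
Proof.
move=> Jab eab min; apply: xget_unique.
  split; first by exists (a, b).
  by move=> _ [[c d] /= [Jcd ecd] <-]; have := min c d Jcd ecd; lia.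
move=> h [[[c d] /= [Jcd ecd] <-] ub].
have := min c d Jcd ecd.
have := ub _ (ex_intro2 _ _ (a, b) (conj Jab eab) erefl).
by move=> /=; lia.
Qed.

(** The default value of [xget] is 0, so a nonzero height is an attained maximum. *)
Lemma height_neq0 (k : nat) (J : set (int * int)) (p : nat) :
  height k J p <> 0 -> exists a b, [/\ J (a, b),
    a - b = 2 * k%:Z + 2 - p%:Z, height k J p = 2 * k%:Z + 1 - a - b &
    forall c d, J (c, d) -> c - d = 2 * k%:Z + 2 - p%:Z -> b <= d].
Proof.
rewrite /height; case: xgetP => // h -> [[[a b] /= [Jab eab] eh] ub] _.
exists a, b; split=> // c d Jcd ecd.
by have /= := ub _ (ex_intro2 _ _ (c, d) (conj Jcd ecd) erefl); lia.
Qed.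

(** * From admissible ideals of P' to balanced ideals of Q *)

Section Admissible.
Context (k : nat) (I : set (nat * nat)) (adI : admissible k I).
Let J := fmap k I.

Lemma admissible_up (a b c d : nat) : Pprime k (c, d) -> I (a, b) ->
  (a <= c)%N -> (b <= d)%N -> I (c, d).
Proof.
by case: adI => -[_ Iup] _ _ Px Iy ? ?; apply: (Iup _ (a, b)) => //; apply/andP.
Qed.

Lemma fmap_order_ideal : order_ideal (Qset k) (leQ k) J.
Proof.
split=> [z [[x [_ Lx] <-]|[[]//]]|x y Qx Jy xy]; first by case: (fL_Qplus Lx).
suff step u v : J v -> Qstep k u v -> J u.
  elim: xy Jy Qx => [u v uv Jv _|//|u v w uv IHu vw IHv Jw Qu].
    exact: step Jv uv.
  apply: IHu => //; apply: IHv => //.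
  by elim: uv Qu => // [? ? []//|? ? ? _ IH1 _ IH2 /IH1].
case: adI => _ noLR noRL.
case: u v => c d [a b] Jv [Qu Qv st]; have b0 := fmap_ge0 Jv.
(* A generating step raises the coordinate sum by one: it stays in Q^+, stays in Q^-, or crosses
   from sum 2k to sum 2k + 1. *)
have [s|s] := lerP (c + d) (2 * k%:Z).
  have d0 : 0 <= d by case: st => -[]; lia.
  have [[c' d'] Lu eu] : exists2 x, Lset k x & fL x = (c, d) by exact: QplusP.
  have [[a' b'] Lv ev] : exists2 x, Lset k x & fL x = (a, b).
    by apply: QplusP => //; split=> //=; case: st => -[]; lia.
  move: Jv; rewrite /J -ev -eu (fmap_fL _ Lv) (fmap_fL _ Lu) => Iv.
  apply: admissible_up Iv _ _; first by case: Lu.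
    by case: eu ev => ? ? [? ?]; case: st => -[]; lia.
  by case: eu ev => ? ? [? ?]; case: st => -[]; lia.
have mu : Qminus k (c, d) by split=> //=; lia.
have [kd|dk] := lerP k%:Z d; first exact: fmap_top.
have [[c' d'] Ru eu] := QminusP mu dk.
rewrite /J -eu (fmap_fR _ Ru) => Iu.
have [s'|s'] := lerP (a + b) (2 * k%:Z); last first.
  have mv : Qminus k (a, b) by split=> //=; lia.
  have [|[a' b'] Rv ev] := QminusP mv; first by case: st => -[]; lia.
  move: Jv; rewrite /J -ev (fmap_fR _ Rv); apply.
  apply: admissible_up Iu _ _; first by case: Rv.
    by case: eu ev => ? ? [? ?]; case: st => -[]; lia.
  by case: eu ev => ? ? [? ?]; case: st => -[]; lia.
have [[a' b'] Lv ev] : exists2 x, Lset k x & fL x = (a, b) by exact: QplusP.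
move: Jv; rewrite /J -ev (fmap_fL _ Lv) => Iv.
case: eu ev => ? ? [? ?]; move: Lv Ru => /LsetE[? ?] /RsetE[? ?].
(* The lower sum is 2k, so (a', b') is l_i with i = a' - k. Moving in the first coordinate reaches
   f_R(r_i), moving in the second f_R(r_(i-1)). *)
case: st => -[? ?].
  apply: noLR; exists (a' - k)%N; rewrite /lpt /rpt; split; first lia.
    by have <- : (a', b') = (k + (a' - k), k - (a' - k))%N by congr pair; lia.
  by have <- : (c', d') = (a' - k - 1, 2 * k - (a' - k))%N by congr pair; lia.
apply: noRL; exists (a' - k).-1; rewrite /lpt /rpt; split; first lia.
  by have <- : (c', d') = ((a' - k).-1 - 1, 2 * k - (a' - k).-1)%N
    by congr pair; lia.
by have <- : (a', b') = (k + (a' - k).-1.+1, k - (a' - k).-1.+1)%N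
  by congr pair; lia.
Qed.

Lemma fmap_up (a b c d : int) :
  Qset k (c, d) -> J (a, b) -> a <= c -> b <= d -> J (c, d).
Proof. by case/order_ideal_QE: fmap_order_ideal => _; exact. Qed.

Lemma fmap_balanced : balanced k J.
Proof.
have JR : J (3 * k%:Z + 2, k%:Z).
  by apply: fmap_top => //; split=> /=; [apply/QsetE|]; lia.
have JL : J (k%:Z + 1, k%:Z).
  by apply: fmap_top => //; split=> /=; [apply/QsetE|]; lia.
have exR : exists n : nat, `[< J (n%:Z + 2 * k%:Z + 2, n%:Z) >].
  exists k; apply/asboolP.
  by have -> : k%:Z + 2 * k%:Z + 2 = 3 * k%:Z + 2 by lia.
have exL : exists n : nat, `[< J (n%:Z + 1, n%:Z) >] by exists k; apply/asboolP.
case: (ex_minnP exR) => r /asboolP Jr rmin.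
case: (ex_minnP exL) => l /asboolP Jl lmin.
have rk : (r <= k)%N.
  apply: rmin; apply/asboolP.
  by have -> : k%:Z + 2 * k%:Z + 2 = 3 * k%:Z + 2 by lia.
have lk : (l <= k)%N by apply: lmin; apply/asboolP.
have hR : height k J 0 = - 1 - 2 * r%:Z.
  rewrite (height_eq Jr); [lia|lia|] => c d Jcd e; have d0 := fmap_ge0 Jcd.
  suff : (r <= `|d|)%N by lia.
  apply: rmin; apply/asboolP; have -> : `|d|%N%:Z = d by lia.
  by have -> : d + 2 * k%:Z + 2 = c by lia.
have hL : height k J (2 * k + 1) = 2 * k%:Z - 2 * l%:Z.
  rewrite (height_eq Jl); [lia|lia|] => c d Jcd e; have d0 := fmap_ge0 Jcd.
  suff : (l <= `|d|)%N by lia.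
  apply: lmin; apply/asboolP; have -> : `|d|%N%:Z = d by lia.
  by have -> : d + 1 = c by lia.
(* The two heights add up to 2(k - r - l) - 1, so balancedness requires k - 1 <= r + l <= k. *)
have rl_le : (r + l <= k)%N.
  case: r Jr rmin rk hR => [|n] Jr rmin nk _ //.
  (* With c = k - r, f_R(c, c) lies just below the ray starting at r, hence (c, c) is in I. Its
     neighbour (c + 1, c) is then in I, and its image under f_L gives l <= c. *)
  have Rn : Rset k (k - 1 - n, k - 1 - n)%N by apply/RsetE; lia.
  have nJ : ~ J (fR k (k - 1 - n, k - 1 - n)%N).
    move=> Jn; suff : (n < n)%N by rewrite ltnn.
    apply: rmin; apply/asboolP; move: Jn; rewrite /fR /=.
    have -> : 3 * k%:Z + 1 - (k - 1 - n)%N%:Z = n%:Z + 2 * k%:Z + 2 by lia.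
    by have -> : k%:Z - 1 - (k - 1 - n)%N%:Z = n%:Z by lia.
  have In : I (k - 1 - n, k - 1 - n)%N.
    by apply: contrapT => nI; apply: nJ; apply/(fmap_fR _ Rn).
  have Ln : Lset k ((k - 1 - n).+1, k - 1 - n)%N by apply/LsetE; lia.
  have : (l <= k - 1 - n)%N; last lia.
  apply: lmin; apply/asboolP.
  have -> : (k - 1 - n)%N%:Z + 1 = (k - 1 - n).+1%:Z by lia.
  apply/(fmap_fL _ Ln); apply: admissible_up In _ _ => //; by case: Ln.
have rl_ge : (k <= r + l + 1)%N.
  rewrite leqNgt; apply/negP => lt.
  (* Conversely (l + 1, l) in I forces (l + 1, l + 1) in I, so f(I) misses a point of the diagonal a
     - b = 2k + 2 with b = k - 2 - l >= r. *)
  have Ll : Lset k (l.+1, l) by apply/LsetE; lia.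
  have Rl : Rset k (l.+1, l.+1) by apply/RsetE; lia.
  have Il : I (l.+1, l).
    apply/(fmap_fL _ Ll); move: Jl; rewrite /fL /=.
    by have -> : l%:Z + 1 = l.+1%:Z by lia.
  have Il' : I (l.+1, l.+1).
    by apply: admissible_up Il _ _ => //; case: Rl.
  suff /(fmap_fR _ Rl) : J (fR k (l.+1, l.+1)) by apply.
  by apply: fmap_up Jr _ _ => /=; [case: (fR_Qminus Rl)|lia|lia].
split.
- exact: fmap_order_ideal.
- move=> e; have : J (0, -1) by rewrite e; apply/QsetE; lia.
  by move/fmap_ge0.
- by move=> e; move: JR; rewrite e.
- by rewrite hR hL; split; lia.
Qed.

End Admissible.

(** * The inverse map on balanced ideals *)

Definition fmap_inv (k : nat) (J : set (int * int)) : set (nat * nat) :=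
  [set x | Lset k x /\ J (fL x) \/ Rset k x /\ ~ J (fR k x)].

Section Balanced.
Context (k : nat) (J : set (int * int)) (balJ : balanced k J).

Lemma balanced_up (a b c d : int) :
  Qset k (c, d) -> J (a, b) -> a <= c -> b <= d -> J (c, d).
Proof. by case: balJ => /order_ideal_QE[_ +] _ _ _; exact. Qed.

Lemma balanced_Q (a b : int) : J (a, b) -> 1 <= a - b /\ a - b <= 2 * k%:Z + 2.
Proof. by case: balJ => -[JQ _] _ _ _ /JQ /QsetE. Qed.

(* The two extreme diagonals [a - b = 2k + 2] and [a - b = 1] meet J in rays
   starting at [b = r] and [b = l]. *)
Lemma balanced_rays : exists r l : int, [/\ 0 <= r /\ l <= k%:Z,
  forall b : int, J (b + 2 * k%:Z + 2, b) <-> r <= b,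
  forall b : int, J (b + 1, b) <-> l <= b &
  k%:Z - 1 <= r + l /\ r + l <= k%:Z].
Proof.
case: (balJ) => _ _ /eqP/set0P[[x y] Jxy] [h0 h1 hs].
have [|a [r [Jr er hr rmin]]] := @height_neq0 k J 0; first lia.
have rP b : J (b + 2 * k%:Z + 2, b) <-> r <= b.
  split=> [Jb|rb]; first by apply: (rmin _ _ Jb); lia.
  by apply: balanced_up Jr _ _ => /=; [apply/QsetE|..]; lia.
(* Raising the first coordinate carries (c, d) to the diagonal a - b = 2k + 2 at the same d. *)
have Jge c d : J (c, d) -> r <= d.
  move=> Jcd; have := balanced_Q Jcd => -[? ?]; apply/rP.
  by apply: balanced_up Jcd _ _ => /=; [apply/QsetE|..]; lia.
(* The height at 2k + 1 may be 0, where [height_neq0] says nothing, so the minimum on a - b = 1 is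
   found directly: raising y takes (x, y) to (x, x - 1), and [Jge] bounds the second coordinate
   below by r. *)
have exl : exists n : nat, `[< J (r + n%:Z + 1, r + n%:Z) >].
  have := balanced_Q Jxy; have := Jge _ _ Jxy => ? [? ?].
  exists (absz (x - 1 - r)%R); apply/asboolP.
  by apply: balanced_up Jxy _ _ => /=; [apply/QsetE|..]; lia.
case: (ex_minnP exl) => n /asboolP Jn nmin.
have lP b : J (b + 1, b) <-> r + n%:Z <= b.
  split=> [Jb|nb]; last first.
    by apply: balanced_up Jn _ _ => /=; [apply/QsetE|..]; lia.
  have := Jge _ _ Jb => rb; suff : (n <= `|b - r|)%N by lia.
  by apply: nmin; apply/asboolP; have -> : r + (absz (b - r))%:Z = b by lia.
have hl : height k J (2 * k + 1) = 2 * k%:Z - 2 * (r + n%:Z).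
  rewrite (height_eq Jn); [lia|lia|] => c d Jcd e.
  by apply/lP; have -> : d + 1 = c by lia.
by exists r, (r + n%:Z); split=> //; lia.
Qed.

Lemma balanced_ge0 (a b : int) : J (a, b) -> 0 <= b.
Proof.
have [r [l [[? ?] rP _ _]]] := balanced_rays => Jab.
have [? ?] := balanced_Q Jab; apply: (@le_trans _ _ r) => //; apply/rP.
by apply: balanced_up Jab _ _ => /=; [apply/QsetE|..]; lia.
Qed.

Lemma balanced_top (a b : int) : Qset k (a, b) -> k%:Z <= b -> J (a, b).
Proof.
have [r [l [[? ?] _ lP _]]] := balanced_rays => Qab kb.
have Jb : J (b + 1, b) by apply/lP; lia.
by move/QsetE: (Qab) => ?; apply: balanced_up Jb _ _ => //=; lia.
Qed.

Lemma fmap_inv_L (x : nat * nat) : Lset k x -> fmap_inv k J x <-> J (fL x).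
Proof.
move=> Lx; split=> [[[]//|[]]|]; last by left.
by case: x Lx => a b /LsetE[? ?] /RsetE[? ?]; lia.
Qed.

Lemma fmap_inv_R (x : nat * nat) : Rset k x -> fmap_inv k J x <-> ~ J (fR k x).
Proof.
move=> Rx; split=> [[[]|[]//]|]; last by right.
by case: x Rx => a b /RsetE[? ?] /LsetE[? ?]; lia.
Qed.

Lemma fmap_invK : fmap k (fmap_inv k J) = J.
Proof.
apply/seteqP; split=> -[a b].
  case=> [[x [Ix Lx] <-]|[mz nR]]; first exact/(fmap_inv_L Lx).
  have [kb|bk] := lerP k%:Z b; first by apply: balanced_top => //; case: mz.
  have [x Rx ex] := QminusP mz bk; apply: contrapT => nJ.
  by apply: nR; exists x => //; split=> //; apply/(fmap_inv_R Rx); rewrite ex.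
move=> Jz; have Qz : Qset k (a, b) by apply/QsetE; exact: balanced_Q.
have [s|s] := lerP (a + b) (2 * k%:Z).
  have [//|x Lx ex] := @QplusP k a b _ (balanced_ge0 Jz).
  by rewrite -ex; apply/(fmap_fL _ Lx)/(fmap_inv_L Lx); rewrite ex.
have mz : Qminus k (a, b) by split=> //=; lia.
have [kb|bk] := lerP k%:Z b; first exact: fmap_top.
have [x Rx ex] := QminusP mz bk; rewrite -ex.
by apply/(fmap_fR _ Rx) => /(fmap_inv_R Rx); rewrite ex.
Qed.

Lemma fmap_inv_order_ideal : order_ideal (Pprime k) leP' (fmap_inv k J).
Proof.
have [r [l [_ rP lP [rl_ge rl_le]]]] := balanced_rays.
split=> [x [[[]//]|[[]//]]|[c d] [a b] Px Iy /andP[/= ac bd]].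
case: (Pprime_LR Px) => [Lx|Rx].
- apply/(fmap_inv_L Lx); have [Qx _] := fL_Qplus Lx.
  case: Iy => [[_ Jy]|[/RsetE[? ?] nJy]].
    by apply: balanced_up Jy _ _ => //=; lia.
  apply: contrapT => nJx; case/LsetE: Lx => ? ?.
  (* From R into L: pushing both points to the extreme diagonals gives d < l and k - 1 - b < r,
     which with b <= d contradicts r + l <= k. *)
  have dl : d%:Z < l.
    rewrite ltNge; apply/negP => /lP Jd; apply: nJx.
    by apply: balanced_up Jd _ _ => //=; lia.
  have : k%:Z - 1 - b%:Z < r; last lia.
  rewrite ltNge; apply/negP => /rP Jb; apply: nJy.
  by apply: balanced_up Jb _ _ => /=; [apply/QsetE|..]; lia.
- apply/(fmap_inv_R Rx); have [Qx _] := fR_Qminus Rx => Jx.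
  case: Iy => [[/LsetE[? ?] Jy]|[Ry nJy]]; last first.
    have [Qy _] := fR_Qminus Ry.
    by apply: nJy; apply: balanced_up Jx _ _ => //=; lia.
  case/RsetE: Rx => ? ?.
  (* From L into R: the same push gives l <= a - 1 and r <= k - 1 - c, which with a <= c contradicts
     k - 1 <= r + l. *)
  have : l <= a%:Z - 1.
    by apply/lP; apply: balanced_up Jy _ _ => /=; [apply/QsetE|..]; lia.
  have : r <= k%:Z - 1 - c%:Z; last lia.
  by apply/rP; apply: balanced_up Jx _ _ => /=; [apply/QsetE|..]; lia.
Qed.

(** Since f_R(r_i) = l_i + (1, 0) = l_(i+1) + (0, 1), it belongs to J as soon as l_i or l_(i+1)
    does, and r_i is then left out. *)
Lemma fmap_inv_admissible : admissible k (fmap_inv k J).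
Proof.
split; first exact: fmap_inv_order_ideal.
- case=> i [/andP[? ?]]; rewrite /lpt /rpt.
  have Li : Lset k (k + i, k - i)%N by apply/LsetE; lia.
  have Ri : Rset k (i - 1, 2 * k - i)%N by apply/RsetE; lia.
  move=> /(fmap_inv_L Li) Jl /(fmap_inv_R Ri); apply.
  have [Qr _] := fR_Qminus Ri.
  by apply: balanced_up Jl _ _ => //=; lia.
- case=> i [/andP[? ?]]; rewrite /lpt /rpt.
  have Li : Lset k (k + i.+1, k - i.+1)%N by apply/LsetE; lia.
  have Ri : Rset k (i - 1, 2 * k - i)%N by apply/RsetE; lia.
  move=> + /(fmap_inv_L Li) Jl => /(fmap_inv_R Ri); apply.
  have [Qr _] := fR_Qminus Ri.
  by apply: balanced_up Jl _ _ => //=; lia.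
Qed.

End Balanced.

(** * Bijectivity *)

Lemma fmap_inj (k : nat) (I I' : set (nat * nat)) :
  I `<=` Pprime k -> fmap k I = fmap k I' -> I `<=` I'.
Proof.
move=> IP e x Ix; case: (Pprime_LR (IP _ Ix)) => [Lx|Rx].
  by apply/(fmap_fL _ Lx); rewrite -e; apply/(fmap_fL _ Lx).
apply: contrapT => /(fmap_fR _ Rx); rewrite -e => /(fmap_fR _ Rx); exact.
Qed.

Local Close Scope ring_scope.

Theorem theorem3p13 (k : nat) (hk : (1 <= k)%N) :
  set_bij [set I : set (nat * nat) | admissible k I]
          [set J : set (int * int) | balanced k J]
          (fmap k).
Proof.
split.
- by move=> I; exact: fmap_balanced.
- move=> I I' /set_mem[[IP _] _ _] /set_mem[[IP' _] _ _] e.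
  by apply/seteqP; split; [exact: fmap_inj e|exact: fmap_inj (esym e)].
- move=> J balJ; exists (fmap_inv k J); first exact: fmap_inv_admissible.
  exact: fmap_invK.
Qed.
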